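(* Let $$F(t^1,t^2,t^3)=\frac12(t^1)^2t^3+\frac12t^1(t^2)^2+\frac16(t^2)^3(t^3)^2+\frac1{20}(t^2)^2(t^3)^5+\frac1{3960}(t^3)^{11}$$ be the Dubrovin–Frobenius potential of the Coxeter group $H_3$. Then the function $$F^o(t^1,t^2,t^3,s)=s t^1+\frac{(t^2)^2}{2 s}+t^2 \left(\frac{(t^3)^2 s}{2}-\frac{t^3 s^3}{4}+\frac{s^5}{40}\right)-\frac{(t^3)^2 s^7}{32}+\frac{(t^3)^3 s^5}{8}-\frac{5 (t^3)^4 s^3}{24}+\frac{(t^3)^5 s}{10}+\frac{t^3 s^9}{288}-\frac{s^{11}}{7040},$$ defined for $s\neq 0$, is a solution of the open WDVV equations associated to $F$. It satisfies the quasihomogeneity equation $$t^1 \frac{\partial F^{o}}{\partial t^1}+\frac{3}{5}t^2 \frac{\partial F^{o}}{\partial t^2}+\frac{1}{5}t^3 \frac{\partial F^{o}}{\partial t^3}+\frac{1}{10} s\frac{\partial F^{o}}{\partial s} = \frac{11}{10} F^{o}$$ and the conditions $\frac{\partial^2F^o}{\partial t^1\partial t^\alpha}=0$ for $1\le\alpha\le3$ and $\frac{\partial^2F^o}{\partial t^1\partial s}=1$.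
   Context: Here $t^1,t^2,t^3,s$ are complex variables (superscripts on $t$ are indices), and repeated Greek indices are summed from $1$ to $N=3$. The constant matrix is $\eta_{\alpha\beta}=\frac{\partial^3F}{\partial t^1\partial t^\alpha\partial t^\beta}$, so $\eta_{13}=\eta_{31}=\eta_{22}=1$ and all other entries are $0$; $(\eta^{\alpha\beta})$ denotes its inverse. The open WDVV equations associated to $F$, for an unknown function $F^o(t^1,\dots,t^N,s)$, are the following two families of equations, required for all $1\le\alpha,\beta,\gamma\le N$: $$\frac{\partial^3F}{\partial t^{\alpha}\partial t^{\beta}\partial t^{\mu}}\eta^{\mu\nu}\frac{\partial^2 F^{o}}{\partial t^{\nu}\partial t^{\gamma}}+\frac{\partial^2 F^{o}}{\partial t^{\alpha}\partial t^{\beta}}\frac{\partial^2 F^{o}}{\partial s\partial t^{\gamma}}=\frac{\partial^3F}{\partial t^{\gamma}\partial t^{\beta}\partial t^{\mu}}\eta^{\mu\nu}\frac{\partial^2 F^{o}}{\partial t^{\nu}\partial t^{\alpha}}+\frac{\partial^2 F^{o}}{\partial t^{\gamma}\partial t^{\beta}}\frac{\partial^2 F^{o}}{\partial s\partial t^{\alpha}},$$ $$\frac{\partial^3F}{\partial t^{\alpha}\partial t^{\beta}\partial t^{\mu}}\eta^{\mu\nu}\frac{\partial^2 F^{o}}{\partial t^{\nu}\partial s}+\frac{\partial^2 F^{o}}{\partial t^{\alpha}\partial t^{\beta}}\frac{\partial^2 F^{o}}{\partial s^2}=\frac{\partial^2 F^{o}}{\partial s\partial t^{\beta}}\frac{\partial^2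 F^{o}}{\partial s\partial t^{\alpha}}.$$ *)

(* Defs.v *)
From mathcomp Require Import all_boot all_order all_algebra.
From mathcomp Require Import complex.
From mathcomp Require Import all_classical all_reals all_analysis.

Set Implicit Arguments.
Unset Strict Implicit.
Unset Printing Implicit Defensive.

Import Order.TTheory GRing.Theory Num.Theory.
Import numFieldNormedType.Exports.
Local Open Scope classical_set_scope.
Local Open Scope ring_scope.

Section OpenWDVV.
Context {K : numFieldType} {N : nat}.
Implicit Types (F : 'rV[K]_N.+1 -> K) (f : 'rV[K]_N.+1 * K -> K).

Definition dclosed (a : 'I_N.+1) F : 'rV[K]_N.+1 -> K := 'D_(delta_mx 0 a) F.

Definition dt (a : 'I_N.+1) f : 'rV[K]_N.+1 * K -> K :=
  'D_((delta_mx 0 a, 0) : 'rV[K]_N.+1 * K) f.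

Definition ds f : 'rV[K]_N.+1 * K -> K := 'D_((0, 1) : 'rV[K]_N.+1 * K) f.

(* Index 0 plays the role of the distinguished variable t^1. *)
Definition eta F (t : 'rV[K]_N.+1) : 'M[K]_N.+1 :=
  \matrix_(a, b) dclosed 0 (dclosed a (dclosed b F)) t.

(* c_{ab}^n = (d^3 F / dt^a dt^b dt^m) eta^{mn} *)
Definition structure_cst F (a b n : 'I_N.+1) (t : 'rV[K]_N.+1) : K :=
  \sum_m dclosed a (dclosed b (dclosed m F)) t * invmx (eta F t) m n.

Definition open_WDVV1 F f (a b g : 'I_N.+1) (p : 'rV[K]_N.+1 * K) : Prop :=
  \sum_n structure_cst F a b n p.1 * dt n (dt g f) p
    + dt a (dt b f) p * ds (dt g f) p =
  \sum_n structure_cst F g b n p.1 * dt n (dt a f) p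
    + dt g (dt b f) p * ds (dt a f) p.

Definition open_WDVV2 F f (a b : 'I_N.+1) (p : 'rV[K]_N.+1 * K) : Prop :=
  \sum_n structure_cst F a b n p.1 * dt n (ds f) p
    + dt a (dt b f) p * ds (ds f) p =
  ds (dt b f) p * ds (dt a f) p.

(* 'D_v f is total, so the existence of the partial derivatives of order at
   most two has to be required separately; when K is the field of complex
   numbers, differentiability on an open set D is holomorphy. *)
Definition twice_differentiable_on (D : set ('rV[K]_N.+1 * K)) f : Prop :=
  forall p, D p ->
    [/\ differentiable f p,
        forall a, differentiable (dt a f) p &
        differentiable (ds f) p].

Definition open_WDVV_solution F (D : set ('rV[K]_N.+1 * K)) f : Prop :=
  [/\ twice_differentiable_on D f,
      forall p, D p -> forall a b g, open_WDVV1 F f a b g p &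
      forall p, D p -> forall a b, open_WDVV2 F f a b p].

End OpenWDVV.

Section H3.
Variable K : numFieldType.

Definition F_H3 (t : 'rV[K]_3) : K :=
  let t1 := t 0 0 in let t2 := t 0 1 in let t3 := t 0 2 in
  1 / 2 * t1 ^+ 2 * t3 + 1 / 2 * t1 * t2 ^+ 2 + 1 / 6 * t2 ^+ 3 * t3 ^+ 2
  + 1 / 20 * t2 ^+ 2 * t3 ^+ 5 + 1 / 3960 * t3 ^+ 11.

Definition Fo_H3 (p : 'rV[K]_3 * K) : K :=
  let t1 := p.1 0 0 in let t2 := p.1 0 1 in let t3 := p.1 0 2 in
  let s := p.2 in
  s * t1 + t2 ^+ 2 / (2 * s)
  + t2 * (t3 ^+ 2 * s / 2 - t3 * s ^+ 3 / 4 + s ^+ 5 / 40)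
  - t3 ^+ 2 * s ^+ 7 / 32 + t3 ^+ 3 * s ^+ 5 / 8 - 5 * t3 ^+ 4 * s ^+ 3 / 24
  + t3 ^+ 5 * s / 10 + t3 * s ^+ 9 / 288 - s ^+ 11 / 7040.

End H3.

(* Main.v *)
From HB Require Import structures.
Require Import Defs.
From mathcomp Require Import all_boot all_order all_algebra.
From mathcomp Require Import complex.
From mathcomp Require Import all_classical all_reals all_analysis.
From mathcomp Require Import ring.

Set Implicit Arguments.
Unset Strict Implicit.
Unset Printing Implicit Defensive.

Import Order.TTheory GRing.Theory Num.Theory.
Import numFieldNormedType.Exports.
Local Open Scope classical_set_scope.
Local Open Scope ring_scope.

(* All derivatives are computed symbolically: the potentials are values of
   rational expressions in the coordinates, formal partial derivatives of such
   expressions compute the actual ones wherever no denominator vanishes, and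
   this set is open, so the computation can be iterated. The claims then become
   identities between explicit rational functions of t^2, t^3 and s. *)

(** * Differentiability is local *)

(** The difference [k] of the two functions vanishes near [p], so the zero map is its differential
    there, and [g = f + k]. *)
Lemma near_eq_differentiable (K : numFieldType) (V W : normedModType K)
    (f g : V -> W) (p : V) :
  (\near p, f p = g p) -> differentiable f p -> differentiable g p.
Proof.
move=> fg df; pose k := g - f.
have k0 : \forall q \near p, k q = 0.
  by near=> q; rewrite /k !fctE (near fg q) ?subrr.
pose z : {linear V -> W} := \0%R.
have ko : k \o shift p = cst (k p) + z +o_ 0 id.
  have kp0 := nbhs_singleton k0.
  apply/eqaddoP => _/posnumP[e]; move: k0; rewrite (near_shift 0) subr0 => k0.
  near=> h; rewrite !fctE /z /= kp0.
  have -> : k (h + p) = 0 by near: h.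
  by rewrite addr0 subr0 normr0 mulr_ge0.
have kd : 'd k p = z :> (V -> W).
  by apply: diff_unique ko; exact: cst_continuous.
have -> : g = f + k by rewrite /k addrC subrK.
apply: differentiableD => //; apply/diff_locallyP; rewrite kd.
by split => //; exact: cst_continuous.
Unshelve. all: by end_near. Qed.

(** * Formal differentiation of rational expressions *)

Inductive expr (K : Type) (I : Type) :=
| Cst of K
| Var of I
| Add of expr K I & expr K I
| Opp of expr K I
| Mul of expr K I & expr K I
| Inv of expr K I
| Exp of expr K I & nat.

Section Expr.
Context {K : numFieldType} {V : normedModType K} {I : eqType}.
(** Coordinates [x] and directions [b] dual to them are kept abstract, so that one calculus serves
    both the closed variables and the open ones. *)
Variables (x : I -> {linear V -> K}) (b : I -> V).
Hypothesis x_continuous : forall i, continuous (x i).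
Hypothesis xb : forall i j, x i (b j) = (i == j)%:R.
Implicit Types (e : expr K I) (p : V).

Fixpoint eval e p : K :=
  match e with
  | Cst c => c
  | Var i => x i p
  | Add e1 e2 => eval e1 p + eval e2 p
  | Opp e1 => - eval e1 p
  | Mul e1 e2 => eval e1 p * eval e2 p
  | Inv e1 => (eval e1 p)^-1
  | Exp e1 n => eval e1 p ^+ n
  end.

Fixpoint defined e p : bool :=
  match e with
  | Cst _ | Var _ => true
  | Add e1 e2 | Mul e1 e2 => defined e1 p && defined e2 p
  | Opp e1 | Exp e1 _ => defined e1 p
  | Inv e1 => defined e1 p && (eval e1 p != 0)
  end.

(** In the [Inv] case the square is taken outside the inverse, so that the only denominators are
    those already in [e1]. In the [Exp] case with [n = 0], the factor [n%:R] vanishes and the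
    truncated [n.-1] is harmless. *)
Fixpoint pderiv (j : I) e : expr K I :=
  match e with
  | Cst _ => Cst _ 0
  | Var i => Cst _ (i == j)%:R
  | Add e1 e2 => Add (pderiv j e1) (pderiv j e2)
  | Opp e1 => Opp (pderiv j e1)
  | Mul e1 e2 => Add (Mul e1 (pderiv j e2)) (Mul e2 (pderiv j e1))
  | Inv e1 => Mul (Opp (Exp (Inv e1) 2)) (pderiv j e1)
  | Exp e1 n => Mul (Mul (Cst _ n%:R) (Exp e1 n.-1)) (pderiv j e1)
  end.

(** Differentiation neither creates nor removes poles, so iterated derivatives live on one fixed
    domain. *)
Lemma defined_pderiv j e p : defined (pderiv j e) p = defined e p.
Proof.
elim: e => //= [e1 -> e2 -> //|e1 -> e2 ->|e1 ->|e1 -> n].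
- by case: (defined e1 p); case: (defined e2 p).
- by rewrite andbAC andbb.
- by rewrite andbb.
Qed.

Lemma differentiable_eval e p : defined e p -> differentiable (eval e) p.
Proof.
elim: e => /= [c|i|e1 IH1 e2 IH2|e1 IH1|e1 IH1 e2 IH2|e1 IH1|e1 IH1 n].
- by move=> _; exact: differentiable_cst.
- by move=> _; exact: linear_differentiable.
- by case/andP => /IH1 d1 /IH2 d2; exact: differentiableD.
- by move=> /IH1 d1; exact: differentiableN.
- by case/andP => /IH1 d1 /IH2 d2; exact: differentiableM.
- by case/andP => /IH1 d1 n0; exact: differentiableV.
- case: n => [|n] /IH1 d1; first exact: differentiable_cst.
  rewrite (_ : (fun _ => _) = eval e1 ^+ n.+1); first exact: differentiableX.
  by apply/funext => q; rewrite exprfctE.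
Qed.

Lemma derive_eval j e p :
  defined e p -> 'D_(b j) (eval e) p = eval (pderiv j e) p.
Proof.
elim: e => /= [c|i|e1 IH1 e2 IH2|e1 IH1|e1 IH1 e2 IH2|e1 IH1|e1 IH1 n].
- by move=> _; exact: derive_cst.
- move=> _; rewrite deriveE; last exact: linear_differentiable.
  by rewrite diff_lin // xb.
- case/andP => d1 d2; rewrite -IH1 // -IH2 //.
  by apply: deriveD; apply/diff_derivable/differentiable_eval.
- move=> d1; rewrite -IH1 //.
  by apply: deriveN; apply/diff_derivable/differentiable_eval.
- case/andP => d1 d2; rewrite -IH1 // -IH2 //.
  by apply: deriveM; apply/diff_derivable/differentiable_eval.
- case/andP => d1 n0; rewrite -IH1 // exprVn.
  by apply: deriveV => //; apply/diff_derivable/differentiable_eval.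
- move=> d1; rewrite -IH1 //.
  have /derivableP d : derivable (eval e1) p (b j).
    exact/diff_derivable/differentiable_eval.
  rewrite (_ : (fun _ => _) = eval e1 ^+ n) ?derive_val //.
  by apply/funext => q; rewrite exprfctE.
Qed.

(** A denominator is continuous where it is defined, hence stays nonzero near a point where it is
    nonzero. *)
Lemma near_defined e p : defined e p -> \forall q \near p, defined e q.
Proof.
elim: e => /= [c|i|e1 IH1 e2 IH2|e1 IH1|e1 IH1 e2 IH2|e1 IH1|e1 IH1 n] //.
- by move=> _; exact: nearW.
- by move=> _; exact: nearW.
- by case/andP => /IH1 d1 /IH2 d2; near=> q; apply/andP; split; near: q.
- by case/andP => /IH1 d1 /IH2 d2; near=> q; apply/andP; split; near: q.
- case/andP => d1 n0; near=> q; apply/andP; split; near: q; first exact: IH1.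
  have /differentiable_continuous := differentiable_eval d1.
  by move=> /cvgr_neq0; apply.
Unshelve. all: by end_near. Qed.

(** Nothing is claimed at poles, where actual and formal derivatives need not agree. *)
Definition denotes (f : V -> K) e := forall p, defined e p -> f p = eval e p.

Lemma near_denotes f e p :
  denotes f e -> defined e p -> \forall q \near p, f q = eval e q.
Proof. by move=> fe /near_defined; apply: filterS. Qed.

(** The domain is open, so [f] agrees with [eval e] near each of its points, and a derivative
    depends only on such local values. The conclusion is again a [denotes], which permits
    iteration. *)
Lemma denotes_derive j f e :
  denotes f e -> denotes ('D_(b j) f) (pderiv j e).
Proof.
move=> fe p; rewrite defined_pderiv => d; rewrite -derive_eval //.
exact/near_eq_derive/near_denotes.
Qed.

Lemma denotes_differentiable f e p :
  denotes f e -> defined e p -> differentiable f p.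
Proof.
move=> fe d; apply: near_eq_differentiable (differentiable_eval d).
by near=> q; rewrite (near (near_denotes fe d) q).
Unshelve. all: by end_near. Qed.

End Expr.

(** * Coordinates and dual directions for the closed and open variables *)

Section Coordinates.
Context {K : numFieldType} {N : nat}.

Definition closed_coord (i : 'I_N) (t : 'rV[K]_N) : K := t 0 i.

Fact closed_coord_is_linear i : linear (closed_coord i).
Proof. by move=> c t u; rewrite /closed_coord !mxE. Qed.

HB.instance Definition _ i := GRing.isLinear.Build K 'rV[K]_N K _
  (closed_coord i) (closed_coord_is_linear i).

Lemma closed_coord_delta i j : closed_coord i (delta_mx 0 j) = (i == j)%:R.
Proof. by rewrite /closed_coord mxE eqxx. Qed.

Lemma closed_coord_continuous i : continuous (closed_coord i).
Proof. exact: coord_continuous. Qed.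

(* The index [None] stands for the variable s. *)
Definition open_coord (i : option 'I_N) (p : 'rV[K]_N * K) : K :=
  if i is Some a then p.1 0 a else p.2.

Definition open_basis (i : option 'I_N) : 'rV[K]_N * K :=
  if i is Some a then (delta_mx 0 a, 0) else (0, 1).

Fact open_coord_is_linear i : linear (open_coord i).
Proof. by case: i => [a|] c p q; rewrite /open_coord /= ?mxE. Qed.

HB.instance Definition _ i := GRing.isLinear.Build K ('rV[K]_N * K)%type K _
  (open_coord i) (open_coord_is_linear i).

Lemma open_coord_basis i j : open_coord i (open_basis j) = (i == j)%:R.
Proof. by case: i j => [a|] [b|] //=; rewrite mxE ?eqxx. Qed.

Lemma open_coord_continuous i : continuous (open_coord i).
Proof.
case: i => [a|] p /=; last exact: cvg_snd.
apply: (@continuous_comp _ _ _ fst (fun t : 'rV[K]_N => t 0 a)).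
  exact: cvg_fst.
exact: coord_continuous.
Qed.

End Coordinates.

(** * Explicit handling of three indices *)

Lemma sum_ord3 (W : nmodType) (h : 'I_3 -> W) :
  \sum_n h n = h 0 + h 1 + h 2.
Proof.
rewrite !big_ord_recl big_ord0 addr0 addrA.
by congr (h _ + h _ + h _); exact: val_inj.
Qed.

Lemma rev_ord3 :
  (rev_ord 0 = 2 :> 'I_3) * (rev_ord 1 = 1 :> 'I_3) * (rev_ord 2 = 0 :> 'I_3).
Proof. by do !split; exact: val_inj. Qed.

(** Case analysis that leaves the literals [0], [1], [2] in the goals instead of [Ordinal] terms. *)
Lemma ord3_ind (P : 'I_3 -> Prop) : P 0 -> P 1 -> P 2 -> forall i, P i.
Proof.
move=> P0 P1 P2 [[|[|[|//]]] lti].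
- by rewrite (_ : Ordinal lti = 0) //; apply/val_inj.
- by rewrite (_ : Ordinal lti = 1) //; apply/val_inj.
- by rewrite (_ : Ordinal lti = 2) //; apply/val_inj.
Qed.

(* Stated for abstract [F] and [f]: with the concrete potentials, a failed
   match between two distinct partial derivatives makes unification unfold
   everything. *)
Section ReplaceDerivatives.
Context {K : numFieldType} {N : nat}.
Variables (F : 'rV[K]_N.+1 -> K) (f : 'rV[K]_N.+1 * K -> K).
Variables (p : 'rV[K]_N.+1 * K) (c : 'I_N.+1 -> 'I_N.+1 -> 'I_N.+1 -> K).
Variable h : option 'I_N.+1 -> option 'I_N.+1 -> K.
Hypothesis cE : forall a b n, structure_cst F a b n p.1 = c a b n.
Hypothesis h_tt : forall a b, dt a (dt b f) p = h (Some a) (Some b).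
Hypothesis h_ts : forall a, dt a (ds f) p = h (Some a) None.
Hypothesis h_st : forall a, ds (dt a f) p = h None (Some a).
Hypothesis h_ss : ds (ds f) p = h None None.

Lemma open_WDVV1E a b g :
  open_WDVV1 F f a b g p =
  (\sum_n c a b n * h (Some n) (Some g) + h (Some a) (Some b) * h None (Some g)
   = \sum_n c g b n * h (Some n) (Some a)
     + h (Some g) (Some b) * h None (Some a)).
Proof.
rewrite /open_WDVV1; congr (_ + _ = _ + _).
- by apply: eq_bigr => n _; rewrite cE h_tt.
- by rewrite h_tt h_st.
- by apply: eq_bigr => n _; rewrite cE h_tt.
- by rewrite h_tt h_st.
Qed.

Lemma open_WDVV2E a b :
  open_WDVV2 F f a b p =
  (\sum_n c a b n * h (Some n) None + h (Some a) (Some b) * h None None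
   = h None (Some b) * h None (Some a)).
Proof.
rewrite /open_WDVV2 h_tt h_ss !h_st; congr (_ + _ = _).
by apply: eq_bigr => n _; rewrite cE h_ts.
Qed.

End ReplaceDerivatives.

(** * Tables of derivatives of the two $H_3$ potentials *)

Section H3.
Variable K : numFieldType.

Let c {I : Type} n : expr K I := Cst I n%:R^-1.

Definition F_expr : expr K 'I_3 :=
  let t1 := Var K 0 in let t2 := Var K 1 in let t3 := Var K 2 in
  Add (Add (Add (Add (Mul (Mul (c 2) (Exp t1 2)) t3)
    (Mul (Mul (c 2) t1) (Exp t2 2))) (Mul (Mul (c 6) (Exp t2 3)) (Exp t3 2)))
    (Mul (Mul (c 20) (Exp t2 2)) (Exp t3 5))) (Mul (c 3960) (Exp t3 11)).

Lemma F_exprE t : F_H3 t = eval closed_coord F_expr t.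
Proof. by rewrite /F_H3 !div1r. Qed.

(* The [nat] literal 7040 is too large to be parsed to a numeral in unary, and
   [field] does not recognize it: hence 32 * 220. *)
Definition Fo_expr : expr K (option 'I_3) :=
  let t1 := Var K (Some 0) in let t2 := Var K (Some 1) in
  let t3 := Var K (Some 2) in let s := Var K None in
  Add (Add (Add (Add (Add (Add (Add (Add
    (Mul s t1)
    (Mul (Mul (c 2) (Exp t2 2)) (Inv s)))
    (Mul t2 (Add (Add (Mul (Mul (c 2) (Exp t3 2)) s)
       (Opp (Mul (c 4) (Mul t3 (Exp s 3))))) (Mul (c 40) (Exp s 5)))))
    (Opp (Mul (Mul (c 32) (Exp t3 2)) (Exp s 7))))
    (Mul (Mul (c 8) (Exp t3 3)) (Exp s 5)))
    (Opp (Mul (Mul (Cst _ (5 / 24)) (Exp t3 4)) (Exp s 3))))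
    (Mul (Mul (c 10) (Exp t3 5)) s))
    (Mul (Mul (c 288) t3) (Exp s 9)))
    (Opp (Mul (Cst _ (32 * 220)^-1) (Exp s 11))).

Lemma Fo_exprE p : Fo_H3 p = eval open_coord Fo_expr p.
Proof.
have E : 7040 = 32 * 220 :> K by rewrite -natrM; congr (_%:R).
rewrite /Fo_H3 /= E !invfM; ring.
Qed.

(** The terms of $F$ containing $t^1$ are cubic, so $t^1$ drops out. Digits in names such as [F223]
    count variables from 1, while table positions count from 0. *)
Definition F_third (t : 'rV[K]_3) (a b g : 'I_3) : K :=
  let x := t 0 1 in let y := t 0 2 in
  let F223 := 2 * x * y + y ^+ 4 / 2 in
  let F233 := x ^+ 2 + 2 * x * y ^+ 3 in
  let F333 := 3 * x ^+ 2 * y ^+ 2 + y ^+ 8 / 4 in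
  nth 0 (nth [::] (nth [::]
    [:: [:: [:: 0; 0; 1]; [:: 0; 1; 0]; [:: 1; 0; 0]];
        [:: [:: 0; 1; 0]; [:: 1; y ^+ 2; F223]; [:: 0; F223; F233]];
        [:: [:: 1; 0; 0]; [:: 0; F223; F233]; [:: 0; F233; F333]]] a) b) g.

Lemma dclosed3_F a b g t :
  dclosed a (dclosed b (dclosed g (@F_H3 K))) t = F_third t a b g.
Proof.
pose dd := denotes_derive (@closed_coord_continuous K 3) closed_coord_delta.
have F0 : denotes closed_coord (@F_H3 K) F_expr by move=> q _; exact: F_exprE.
transitivity (eval closed_coord (pderiv a (pderiv b (pderiv g F_expr))) t).
  apply: (dd a _ _ (dd b _ _ (dd g _ _ F0))).
  (* [F_expr] contains no [Inv], so it is defined everywhere. *)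
  by rewrite !defined_pderiv.
elim/ord3_ind: a; elim/ord3_ind: b; elim/ord3_ind: g;
  by rewrite /F_third /= /closed_coord; field.
Qed.

Lemma eta_F t : eta (@F_H3 K) t = \matrix_(i, j) (j == rev_ord i)%:R.
Proof.
apply/matrixP => i j; rewrite !mxE dclosed3_F.
by elim/ord3_ind: i; elim/ord3_ind: j.
Qed.

(** The metric is the matrix of the involution [rev_ord], hence its own inverse; raising an index
    only reverses it, and one term of the sum survives. *)
Lemma structure_cst_F a b n t :
  structure_cst (@F_H3 K) a b n t = F_third t a b (rev_ord n).
Proof.
have etaV : invmx (eta (@F_H3 K) t) = eta (@F_H3 K) t.
  have eta2 : eta (@F_H3 K) t *m eta (@F_H3 K) t = 1%:M.
    apply/matrixP => i j; rewrite eta_F !mxE (bigD1 (rev_ord i)) //= !mxE eqxx.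
    rewrite rev_ordK mul1r eq_sym big1 ?addr0 // => k /negbTE ki.
    by rewrite !mxE ki mul0r.
  have [eta_unit _] := mulmx1_unit eta2.
  by rewrite -[LHS]mulmx1 -eta2 mulKmx.
rewrite /structure_cst etaV eta_F (bigD1 (rev_ord n)) //= big1.
  by rewrite addr0 mxE rev_ordK eqxx mulr1 dclosed3_F.
move=> k kn; rewrite mxE; case: eqP => [nk|_]; last exact: mulr0.
by rewrite nk rev_ordK eqxx in kn.
Qed.

(** Rows and columns are ordered $t^1,t^2,t^3,s$. As $t^1$ occurs only in the term $s t^1$, its row
    and column are constant. *)
Definition Fo_hessian (p : 'rV[K]_3 * K) (i j : option 'I_3) : K :=
  let x := p.1 0 1 in let y := p.1 0 2 in let s := p.2 in
  let F23 := y * s - s ^+ 3 / 4 in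
  let F2s := - x / s ^+ 2 + y ^+ 2 / 2 - 3 / 4 * y * s ^+ 2 + s ^+ 4 / 8 in
  let F33 := x * s - s ^+ 7 / 16 + 3 / 4 * y * s ^+ 5
    - 5 / 2 * y ^+ 2 * s ^+ 3 + 2 * y ^+ 3 * s in
  let F3s := x * (y - 3 / 4 * s ^+ 2) - 7 / 16 * y * s ^+ 6
    + 15 / 8 * y ^+ 2 * s ^+ 4 - 5 / 2 * y ^+ 3 * s ^+ 2 + y ^+ 4 / 2
    + s ^+ 8 / 32 in
  let Fss := x ^+ 2 / s ^+ 3 + x * (s ^+ 3 / 2 - 3 / 2 * y * s)
    - 21 / 16 * y ^+ 2 * s ^+ 5 + 5 / 2 * y ^+ 3 * s ^+ 3
    - 5 / 4 * y ^+ 4 * s + y * s ^+ 7 / 4 - s ^+ 9 / 64 in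
  let index k := if k is Some a then nat_of_ord a else 3 in
  nth 0 (nth [::] [:: [:: 0; 0; 0; 1]; [:: 0; s^-1; F23; F2s];
                      [:: 0; F23; F33; F3s]; [:: 1; F2s; F3s; Fss]]
    (index i)) (index j).

Let dd := denotes_derive (@open_coord_continuous K 3) open_coord_basis.

Let Fo0 : denotes open_coord (@Fo_H3 K) Fo_expr.
Proof. by move=> q _; exact: Fo_exprE. Qed.

(** The only [Inv] in [Fo_expr] is applied to $s$; numerical denominators sit inside constants. *)
Lemma Fo_expr_defined p : p.2 != 0 -> defined open_coord Fo_expr p.
Proof. by move=> /= ->. Qed.

Lemma derive2_Fo i j p : p.2 != 0 ->
  'D_(open_basis i) ('D_(open_basis j) (@Fo_H3 K)) p = Fo_hessian p i j.
Proof.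
move=> s0.
transitivity (eval open_coord (pderiv i (pderiv j Fo_expr)) p).
  apply: (@dd i _ _ (@dd j _ _ Fo0)).
  by rewrite !defined_pderiv Fo_expr_defined.
case: i => [i|]; [elim/ord3_ind: i|]; (case: j => [j|]; [elim/ord3_ind: j|]);
  by rewrite /Fo_hessian /= ; field.
Qed.

(** The first partial derivatives are again denoted by expressions with the same domain. *)
Lemma Fo_twice_differentiable :
  twice_differentiable_on [set p | p.2 != 0] (@Fo_H3 K).
Proof.
move=> p s0.
have diff f e :
    denotes open_coord f e -> defined open_coord e p -> differentiable f p.
  by apply: denotes_differentiable; exact: open_coord_continuous.
split => [|a|].
- exact: diff Fo0 (Fo_expr_defined s0).
- apply: diff (@dd (Some a) _ _ Fo0) _.
  by rewrite defined_pderiv Fo_expr_defined.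
- by apply: diff (@dd None _ _ Fo0) _; rewrite defined_pderiv Fo_expr_defined.
Qed.

(** This is Euler's identity: with weights $1, 3/5, 1/5, 1/10$ for $t^1,t^2,t^3,s$, every monomial
    of $F^o$ has weight $11/10$. *)
Lemma Fo_quasihomogeneous (p : 'rV[K]_3 * K) : p.2 != 0 ->
  p.1 0 0 * dt 0 (@Fo_H3 K) p + 3 / 5 * p.1 0 1 * dt 1 (@Fo_H3 K) p
  + 1 / 5 * p.1 0 2 * dt 2 (@Fo_H3 K) p + 1 / 10 * p.2 * ds (@Fo_H3 K) p
  = 11 / 10 * Fo_H3 p.
Proof.
move=> s0.
have D i :
    'D_(open_basis i) (@Fo_H3 K) p = eval open_coord (pderiv i Fo_expr) p.
  by apply: (@dd i _ _ Fo0); rewrite defined_pderiv Fo_expr_defined.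
(* [dt] and [ds] are convertible to derivatives along [open_basis]; retyping [D] makes it usable for
   rewriting. *)
have Dt a : dt a (@Fo_H3 K) p = _ := D (Some a).
have Ds : ds (@Fo_H3 K) p = _ := D None.
by rewrite !Dt Ds Fo_exprE /=; field.
Qed.

(** * Verification of the open WDVV equations *)

Lemma open_WDVV1_H3 p a b g :
  p.2 != 0 -> open_WDVV1 (@F_H3 K) (@Fo_H3 K) a b g p.
Proof.
move=> s0; have D i j := derive2_Fo i j s0.
rewrite (@open_WDVV1E _ _ _ _ _ _ _ (fun a b n => structure_cst_F a b n p.1)
  (fun a b => D (Some a) (Some b)) (fun a => D None (Some a))).
(* The contraction becomes explicit: $\nu = 1, 2, 3$ is paired with the third lower index $3, 2, 1$
   of the derivatives of $F$. *)
rewrite !sum_ord3 !rev_ord3.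
elim/ord3_ind: a; elim/ord3_ind: b; elim/ord3_ind: g;
  by rewrite /F_third /Fo_hessian /=; field.
Qed.

Lemma open_WDVV2_H3 p a b :
  p.2 != 0 -> open_WDVV2 (@F_H3 K) (@Fo_H3 K) a b p.
Proof.
move=> s0; have D i j := derive2_Fo i j s0.
rewrite (@open_WDVV2E _ _ _ _ _ _ _ (fun a b n => structure_cst_F a b n p.1)
  (fun a b => D (Some a) (Some b)) (fun a => D (Some a) None)
  (fun a => D None (Some a)) (D None None)).
rewrite !sum_ord3 !rev_ord3.
elim/ord3_ind: a; elim/ord3_ind: b;
  by rewrite /F_third /Fo_hessian /=; field.
Qed.

End H3.

Theorem proposition2p1 (R : realType) :
  let C : numFieldType := R[i] in
  let F : 'rV[C]_3 -> C := @F_H3 C in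
  let Fo : 'rV[C]_3 * C -> C := @Fo_H3 C in
  let D : set ('rV[C]_3 * C) := [set p | p.2 != 0] in
  [/\ open_WDVV_solution F D Fo,
      forall p, D p ->
        p.1 0 0 * dt 0 Fo p + 3 / 5 * p.1 0 1 * dt 1 Fo p
        + 1 / 5 * p.1 0 2 * dt 2 Fo p + 1 / 10 * p.2 * ds Fo p
        = 11 / 10 * Fo p,
      forall p, D p -> forall a : 'I_3, dt 0 (dt a Fo) p = 0 &
      forall p, D p -> dt 0 (ds Fo) p = 1].
Proof.
move=> C F Fo D; split => [|p||p].
- split; first exact: Fo_twice_differentiable.
  + by move=> p s0 a b g; exact: open_WDVV1_H3.
  + by move=> p s0 a b; exact: open_WDVV2_H3.
- exact: Fo_quasihomogeneous.
(* The $t^1$ row of [Fo_hessian] is $0, 0, 0, 1$, which yields this claim and the next. *)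
- move=> p s0 a; have := derive2_Fo (Some 0) (Some a) s0.
  by elim/ord3_ind: a.
- by move=> s0; exact: (derive2_Fo (Some 0) None s0).
Qed.
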